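(* Let $k>0$, $\theta>0$, and let $X_1,\dots,X_n$ be i.i.d. samples of a gamma random variable $X$ with pdf $f(x)=\frac{x^{k-1}}{\Gamma(k)\theta^k}\exp(-x/\theta)$ for $0<x<\infty$. Let $\overline{X}_n=\frac1n\sum_{i=1}^nX_i$ and $\varDelta=\min\big\{\frac12,\frac{\mathscr{C}}{\sqrt n}(3+\frac6k)^{3/4}\big\}$, where $\mathscr{C}$ is the Berry–Esseen constant. Then $$\Pr\{\overline{X}_n\le\varrho k\theta\}\le\Big(\frac12+\varDelta\Big)\big[\varrho\exp(1-\varrho)\big]^{kn}\quad\text{for }0<\varrho\le1,$$ $$\Pr\{\overline{X}_n\ge\varrho k\theta\}\le\Big(\frac12+\varDelta\Big)\big[\varrho\exp(1-\varrho)\big]^{kn}\quad\text{for }\varrho\ge1.$$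
   Context: The Berry–Esseen constant $\mathscr{C}$ is a positive absolute constant such that for every random variable $Y$ with $\mathbb{E}[Y]=0$, $\mathbb{E}[Y^2]>0$, $\mathbb{E}[|Y|^3]<\infty$, every $n$ and every $y\in\mathbb{R}$, $|F_n(y)-\Phi(y)|\le\frac{\mathscr{C}}{\sqrt n}\frac{\mathbb{E}[|Y|^3]}{\mathbb{E}^{3/2}[Y^2]}$, where $F_n$ is the cdf of $\sum_{i=1}^nY_i/\sqrt{n\mathbb{E}[Y^2]}$ for i.i.d. copies $Y_i$ of $Y$ and $\Phi$ is the standard normal cdf. *)

(* Defs.v *)
From HB Require Import structures.
From mathcomp Require Import all_boot all_order all_algebra.
From mathcomp Require Import all_classical all_reals all_analysis.
Set Implicit Arguments. Unset Strict Implicit. Unset Printing Implicit Defensive.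
Import Order.TTheory GRing.Theory Num.Theory.
Import numFieldNormedType.Exports.
Local Open Scope classical_set_scope.
Local Open Scope ring_scope.

(* Mutual independence of a finite family of real random variables:
   product rule for all choices of Borel sets (taking B i = setT recovers
   the product rule for every subfamily). *)
Definition mutually_independent d (T : measurableType d) (R : realType)
  (P : probability T R) (n : nat) (X : 'I_n -> {RV P >-> R}) : Prop :=
  forall B : 'I_n -> set R, (forall i, measurable (B i)) ->
    P (\bigcap_(i in [set: 'I_n]) (X i @^-1` B i)) =
    (\prod_(i < n) P (X i @^-1` B i))%E.

Definition same_distribution d (T : measurableType d) (R : realType)
  (P : probability T R) (X Y : {RV P >-> R}) : Prop :=
  forall A : set R, measurable A -> P (X @^-1` A) = P (Y @^-1` A).

Definition Phi (R : realType) (y : R) : R :=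
  fine (\int[@lebesgue_measure R]_(x in `]-oo, y]) (normal_pdf 0 1 x)%:E)%E.

Definition berry_esseen_constant (R : realType) (C : R) : Prop :=
  forall d (T : measurableType d) (P : probability T R) (Y : {RV P >-> R}),
    expectation P Y = 0%E ->
    (0 < expectation P (fun w => (Y w ^+ 2)%R))%E ->
    (expectation P (fun w => (`|Y w| ^+ 3)%R) < +oo)%E ->
    forall (n : nat) (Ys : 'I_n -> {RV P >-> R}),
      (0 < n)%N ->
      mutually_independent Ys ->
      (forall i, same_distribution (Ys i) Y) ->
      forall y : R,
        `| fine (P [set w | (\sum_(i < n) Ys i w) /
                            Num.sqrt (n%:R * fine (expectation P (fun w => (Y w ^+ 2)%R))) <= y])
           - Phi y |
        <= C / Num.sqrt n%:R * fine (expectation P (fun w => (`|Y w| ^+ 3)%R))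
             / (Num.sqrt (fine (expectation P (fun w => (Y w ^+ 2)%R)))) ^+ 3.

Definition Gamma (R : realType) (k : R) : R :=
  fine (\int[@lebesgue_measure R]_(x in `](0%R : R), +oo[) (x `^ (k - 1) * expR (- x))%R%:E)%E.

Definition gamma_pdf (R : realType) (k theta x : R) : R :=
  if 0 < x then x `^ (k - 1) * expR (- x / theta) / (Gamma k * theta `^ k) else 0.

Definition gamma_distributed d (T : measurableType d) (R : realType)
  (P : probability T R) (k theta : R) (X : {RV P >-> R}) : Prop :=
  forall A : set R, measurable A ->
    P (X @^-1` A) = (\int[@lebesgue_measure R]_(x in A) (gamma_pdf k theta x)%:E)%E.

(* Main.v *)
(** Rescaling a gamma variable [Z] of shape [a] by [1/r] amounts to an exponential
change of measure: [E h(Z/r) = r^a E (exp((1-r)Z/theta) h(Z))].  This identity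
[exp_scaling] passes to sums of independent variables, the exponents [a] adding up,
so it holds for [S = X_1 + ... + X_n] with [a = k n].  Taking for [h] the indicator
of a half-line ending at the mean [c = n k theta] bounds the tail of [S] beyond
[rho c] by [(rho exp(1-rho))^(k n)] times the probability that [S] lies on the same
side of [c]; the latter is at most [1/2 + Delta] by Berry-Esseen at [0] applied to
the variables [X_i - k theta] or to their opposites.  The moments needed there also
follow from [exp_scaling], by letting [r] decrease to [1]. *)
Require Import Defs.
From HB Require Import structures.
From mathcomp Require Import all_boot all_order all_algebra.
From mathcomp Require Import all_classical all_reals all_analysis.
From mathcomp Require Import measurable_realfun ring lra.
Set Implicit Arguments. Unset Strict Implicit. Unset Printing Implicit Defensive.
Import Order.TTheory GRing.Theory Num.Theory.
Import numFieldNormedType.Exports.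
Local Open Scope classical_set_scope.
Local Open Scope ring_scope.

(** * Integration against a measure given by a density *)

Section density.
Import HBNNSimple.
Local Open Scope ereal_scope.

(** On indicators the formula is the hypothesis on [nu]. Linearity extends it to simple functions
    increasing to [h], and monotone convergence on both sides extends it to [h] itself. *)
Lemma ge0_integral_density (d : measure_display) (T : measurableType d)
    (R : realType) (mu nu : {measure set T -> \bar R}) (f : T -> R)
    (h : T -> \bar R) :
  measurable_fun setT f -> (forall x, 0 <= f x)%R ->
  (forall A, measurable A -> nu A = \int[mu]_(x in A) (f x)%:E) ->
  measurable_fun setT h -> (forall x, 0 <= h x) ->
  \int[nu]_x h x = \int[mu]_x (h x * (f x)%:E).
Proof.
move=> mf f0 nuE mh h0.
have mfE : measurable_fun setT (EFin \o f) by exact/measurable_EFinP.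
pose u := nnsfun_approx measurableT mh.
have uh x : (u n x)%:E @[n --> \oo] --> h x.
  by apply: cvg_nnsfun_approx => // y _; exact: h0.
have mu_ n : measurable_fun setT (EFin \o u n) by exact/measurable_EFinP.
have ndu x : {homo (fun n => (u n x)%:E) : m n / (m <= n)%N >-> m <= n}.
  by move=> m n mn; rewrite lee_fin; exact/lefP/nd_nnsfun_approx.
have step n : \int[nu]_x (u n x)%:E = \int[mu]_x ((u n x)%:E * (f x)%:E).
  have mI r : measurable (u n @^-1` [set r]) by [].
  under eq_integral do rewrite fimfunE -fsumEFin//.
  under [RHS]eq_integral => x _.
    rewrite fimfunE -fsumEFin// ge0_mule_fsuml; last first.
      by move=> r; exact: nnfun_muleindic_ge0.
    over.
  rewrite !ge0_integral_fsum//; first last.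
  - by move=> r x _; exact: nnfun_muleindic_ge0.
  - by move=> r; exact/measurable_EFinP/measurable_funM.
  - by move=> r x _; rewrite mule_ge0 ?lee_fin//; exact: nnfun_muleindic_ge0.
  - move=> r; apply: emeasurable_funM => //.
    exact/measurable_EFinP/measurable_funM.
  apply: eq_fsbigr => r _.
  under eq_integral do rewrite EFinM.
  rewrite integralZl_indic_nnsfun// integral_indic// setIT nuE//.
  under [RHS]eq_integral do rewrite EFinM -muleA.
  rewrite integral_mkcond.
  have [r0|r0] := leP 0%R r.
    rewrite ge0_integralZl//; last 2 first.
    - by apply: emeasurable_funM => //; exact/measurable_EFinP.
    - by move=> x _; rewrite mule_ge0 ?lee_fin.
    by congr (_ * _); apply: eq_integral => x _; rewrite epatch_indic muleC.
  (* A nonnegative simple function has an empty fibre over a negative level, so both sides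
     vanish. *)
  have -> : u n @^-1` [set r] = set0 by exact: preimage_nnfun0.
  rewrite patch_set0 integral0 mule0.
  by under eq_integral do rewrite indic0 mul0e mule0; rewrite integral0.
transitivity (limn (fun n => \int[nu]_x (u n x)%:E)).
  rewrite -monotone_convergence//.
  - by apply: eq_integral => x _; apply/esym/cvg_lim => //; exact: uh.
  - by move=> n x _; rewrite lee_fin.
under eq_fun do rewrite step.
rewrite -monotone_convergence//.
- apply: eq_integral => x _; apply/cvg_lim => //.
  by apply: cvgeZr => //; exact: uh.
- by move=> n; apply: emeasurable_funM => //; exact: mu_.
- by move=> n x _; rewrite mule_ge0 ?lee_fin.
- by move=> x _ m n mn; rewrite lee_wpmul2r ?lee_fin//; exact: ndu.
Qed.

End density.

(** * Dilations of the Lebesgue measure *)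

Lemma measurable_mulr (R : realType) (r : R) :
  measurable_fun setT (fun x : R => r * x).
Proof. by apply: measurable_funM. Qed.

Section scaling.
Local Open Scope ereal_scope.
Context {R : realType}.
Local Notation mu := (@lebesgue_measure R).

Lemma mulr_preimage_ocitv (r a b : R) : (0 < r)%R ->
  ( *%R r) @^-1` `]a, b]%classic = `](a / r)%R, (b / r)%R]%classic.
Proof.
move=> r0; apply/seteqP; split => x /=; rewrite !in_itv/= ltr_pdivrMr//;
  by rewrite ler_pdivlMr// ![(x * r)%R]mulrC.
Qed.

(** The right-hand side is a measure in [A] giving each half-open interval its length, so uniqueness
    of the Lebesgue measure applies. *)
Lemma lebesgue_measure_mulr (r : R) (A : set R) : (0 < r)%R -> measurable A ->
  mu A = r%:E * mu (( *%R r) @^-1` A).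
Proof.
move=> r0 mA.
pose rn := NngNum (ltW r0).
pose m : {measure set (measurableTypeR R) -> \bar R} :=
  mscale rn (pushforward mu ( *%R r : measurableTypeR R -> measurableTypeR R)).
rewrite (@lebesgue_measure_unique _ (m (measurable_mulr r))) => //= X [[a b] _ <-]/=.
rewrite /mscale/= /pushforward mulr_preimage_ocitv// !lebesgue_measure_itv/= !lte_fin.
rewrite ltr_pM2r ?invr_gt0//; case: ifPn => _; last by rewrite mule0.
by rewrite -!EFinB -EFinM -mulrBl mulrCA divff ?mulr1// gt_eqF.
Qed.

Lemma ge0_integral_mulr (r : R) (g : R -> \bar R) : (0 < r)%R ->
  measurable_fun setT g -> (forall x, 0 <= g x) ->
  \int[mu]_x g x = r%:E * \int[mu]_x g (r * x)%R.
Proof.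
move=> r0 mg g0.
pose rn := NngNum (ltW r0).
pose m : {measure set (measurableTypeR R) -> \bar R} :=
  mscale rn (pushforward mu ( *%R r : measurableTypeR R -> measurableTypeR R)).
rewrite (@eq_measure_integral _ _ _ _ (m (measurable_mulr r))); last first.
  by move=> A mA _; exact: lebesgue_measure_mulr.
rewrite ge0_integral_mscale//; congr (_ * _).
rewrite ge0_integral_pushforward//.
Qed.

End scaling.

(** This is the property of the gamma law that is carried over to sums, so densities are never
    convolved. Taking [h = 1] gives the Laplace transform of a gamma law of shape [a]; nonnegative
    extended-valued [h] avoid any integrability condition. *)
Definition exp_scaling (d : measure_display) (T : measurableType d)
    (R : realType) (P : probability T R) (theta a : R) (Z : T -> R) : Prop :=
  forall (r : R) (h : R -> \bar R), 0 < r ->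
  measurable_fun setT h -> (forall x, (0 <= h x)%E) ->
  (\int[P]_w h (Z w / r)%R =
   (r `^ a)%:E * \int[P]_w ((expR ((1 - r) * Z w / theta))%:E * h (Z w)))%E.

(** * The gamma density and its scaling identity *)

Section gamma.
Context (R : realType).
Implicit Types k theta r x : R.

Lemma Gamma_ge0 k : 0 <= Gamma k.
Proof.
rewrite fine_ge0// integral_ge0// => x _.
by rewrite lee_fin mulr_ge0 ?powR_ge0 ?expR_ge0.
Qed.

Lemma gamma_pdf_ge0 k theta x : 0 <= gamma_pdf k theta x.
Proof.
rewrite /gamma_pdf; case: ifPn => // _.
by rewrite !mulr_ge0 ?invr_ge0 ?mulr_ge0 ?powR_ge0 ?expR_ge0 ?Gamma_ge0.
Qed.

Lemma measurable_gamma_pdf k theta : measurable_fun setT (gamma_pdf k theta).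
Proof.
apply: measurable_fun_ifT => //.
  exact: measurable_fun_ltr.
apply: measurable_funM => //; apply: measurable_funM.
  exact: measurable_powR.
apply: measurableT_comp => //; apply: measurable_funM => //.
Qed.

(** The factor [r] of the dilation and [r^(k-1)] from the power combine into [r^k]. The normalising
    constant is common to both sides, so its value is never computed. *)
Lemma gamma_pdf_mulr k theta r x : 0 < k -> 0 < r ->
  r * gamma_pdf k theta (r * x) =
  r `^ k * expR ((1 - r) * x / theta) * gamma_pdf k theta x.
Proof.
move=> k0 r0; rewrite /gamma_pdf pmulr_rgt0//; case: ifPn => x0; last by rewrite !mulr0.
rewrite powRM ?ltW// -(mulr_powRB1 (ltW r0) k0).
have -> : expR (- (r * x) / theta) = expR ((1 - r) * x / theta) * expR (- x / theta).
  by rewrite -expRD; congr expR; rewrite -mulrDl; congr (_ / _); ring.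
ring.
Qed.

End gamma.

Section gamma_rv.
Local Open Scope ereal_scope.
Context (d : measure_display) (T : measurableType d) (R : realType)
  (P : probability T R) (k theta : R) (X : {RV P >-> R}).
Hypotheses (k0 : (0 < k)%R) (gX : gamma_distributed k theta X).
Local Notation mu := (@lebesgue_measure R).

Lemma gamma_integral (h : R -> \bar R) :
  measurable_fun setT h -> (forall x, 0 <= h x) ->
  \int[P]_w h (X w) = \int[mu]_x (h x * (gamma_pdf k theta x)%:E).
Proof.
move=> mh h0.
have mX : measurable_fun setT (X : T -> measurableTypeR R).
  exact: (measurable_funPT X).
pose nu : {measure set (measurableTypeR R) -> \bar R} :=
  pushforward P (X : T -> measurableTypeR R).
rewrite -(@ge0_integral_density _ _ _ mu (nu mX))//.
- by rewrite ge0_integral_pushforward.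
- exact: measurable_gamma_pdf.
- exact: gamma_pdf_ge0.
Qed.

(** Substituting [r x] for [x] integrates [h x] against [r] times the density at [r x], which
    [gamma_pdf_mulr] turns into the exponentially weighted density. *)
Lemma gamma_exp_scaling : exp_scaling P theta k X.
Proof.
move=> r h r0 mh h0.
have mhr : measurable_fun setT (fun x : R => h (x / r)%R).
  by apply: measurableT_comp => //; exact: measurable_funM.
rewrite (@gamma_integral (fun x => h (x / r)%R))//.
have me : measurable_fun setT (fun x : R => (expR ((1 - r) * x / theta))%:E).
  apply/measurable_EFinP; apply: measurableT_comp => //.
  by do 2 apply: measurable_funM => //.
rewrite (@gamma_integral (fun x => (expR ((1 - r) * x / theta))%:E * h x))//;
  last 2 first.
- exact: emeasurable_funM.
- by move=> x; rewrite mule_ge0// lee_fin expR_ge0.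
have mpdf : measurable_fun setT (fun x => (gamma_pdf k theta x)%:E).
  by apply/measurable_EFinP; exact: measurable_gamma_pdf.
have pdf0 x : 0 <= (gamma_pdf k theta x)%:E by rewrite lee_fin gamma_pdf_ge0.
rewrite (ge0_integral_mulr r0)//; last 2 first.
- exact: emeasurable_funM.
- by move=> x; rewrite mule_ge0.
rewrite -!ge0_integralZl ?lee_fin ?powR_ge0 ?ltW//; first last.
- move=> x _; rewrite mule_ge0//.
- apply: emeasurable_funM.
    by apply: measurableT_comp mhr _; exact: measurable_mulr.
  by apply: measurableT_comp mpdf _; exact: measurable_mulr.
- by move=> x _; rewrite mule_ge0// mule_ge0// lee_fin expR_ge0.
- by apply: emeasurable_funM => //; exact: emeasurable_funM.
apply: eq_integral => x _.
rewrite mulrAC mulfV ?gt_eqF// mul1r muleCA -EFinM gamma_pdf_mulr//.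
by rewrite !EFinM !muleA; congr (_ * _); rewrite -muleA muleC.
Qed.

Lemma gamma_le0 : P [set w | (X w <= 0)%R] = 0.
Proof.
have -> : [set w | (X w <= 0)%R] = X @^-1` `]-oo, 0%R]%classic.
  by apply/seteqP; split => w /=; rewrite in_itv.
rewrite gX// integral0_eq// => x /=; rewrite in_itv/= => x0.
by rewrite /gamma_pdf ltNge x0.
Qed.

End gamma_rv.

(** * Sum of two independent variables *)

Section sum2.
Local Open Scope ereal_scope.
Context (d : measure_display) (T : measurableType d) (R : realType)
  (P : probability T R) (Z W : {RV P >-> R}).
Hypothesis indep : forall A B : set R, measurable A -> measurable B ->
  P (Z @^-1` A `&` W @^-1` B) = P (Z @^-1` A) * P (W @^-1` B).

(** Independence says that the joint law and the product law agree on rectangles, hence everywhere;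
    Tonelli then gives the iterated integral. *)
Lemma indep_integral2 (g : R * R -> \bar R) :
  measurable_fun setT g -> (forall x, 0 <= g x) ->
  \int[P]_w g (Z w, W w) =
  \int[distribution P Z]_z \int[distribution P W]_w g (z, w).
Proof.
move=> mg g0.
have mZW : measurable_fun setT (fun w => (Z w, W w)).
  exact: measurable_fun_pair.
rewrite -(@fubini_tonelli1 _ _ _ _ _ (distribution P Z) (distribution P W))//.
pose m : {measure set (R * R) -> \bar R} := pushforward P (fun w => (Z w, W w)).
rewrite -(@eq_measure_integral _ _ _ _ _ (m mZW)); last first.
  by move=> A mA _; apply/esym/product_measure_unique.
by rewrite ge0_integral_pushforward.
Qed.

(** The weight [e] is multiplicative on sums, so the identity can be applied to one variable at a
    time inside the iterated integral. *)
Lemma exp_scalingD (theta a b : R) :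
  exp_scaling P theta a Z -> exp_scaling P theta b W ->
  exp_scaling P theta (a + b) (Z \+ W)%R.
Proof.
move=> sZ sW r h r0 mh h0.
pose mZ := distribution P Z; pose mW := distribution P W.
have distZ (f : R -> \bar R) : measurable_fun setT f -> (forall x, 0 <= f x) ->
    \int[mZ]_x f x = \int[P]_w f (Z w).
  by move=> mf f0; rewrite (@ge0_integral_distribution _ _ _ _ _ P Z).
have distW (f : R -> \bar R) : measurable_fun setT f -> (forall x, 0 <= f x) ->
    \int[mW]_x f x = \int[P]_w f (W w).
  by move=> mf f0; rewrite (@ge0_integral_distribution _ _ _ _ _ P W).
pose e x : \bar R := (expR ((1 - r) * x / theta))%:E.
have e0 x : 0 <= e x by rewrite lee_fin expR_ge0.
have me : measurable_fun setT e.
  apply/measurable_EFinP; apply: measurableT_comp => //.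
  by do 2 apply: measurable_funM => //.
have eD x y : e (x + y)%R = e x * e y.
  by rewrite /e -EFinM -expRD; congr (expR _)%:E; ring.
have mD : measurable_fun setT (fun x : R * R => (x.1 + x.2)%R).
  exact: measurable_funD.
have mV : measurable_fun setT (fun x : R => x / r)%R by exact: measurable_funM.
have scZ (f : R -> \bar R) : measurable_fun setT f -> (forall x, 0 <= f x) ->
    \int[mZ]_x f (x / r)%R = (r `^ a)%:E * \int[mZ]_x (e x * f x).
  move=> mf f0; rewrite distZ//; last exact: measurableT_comp mV.
  rewrite sZ// distZ//; first exact: emeasurable_funM.
  by move=> x; rewrite mule_ge0.
have scW (f : R -> \bar R) : measurable_fun setT f -> (forall x, 0 <= f x) ->
    \int[mW]_x f (x / r)%R = (r `^ b)%:E * \int[mW]_x (e x * f x).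
  move=> mf f0; rewrite distW//; last exact: measurableT_comp mV.
  rewrite sW// distW//; first exact: emeasurable_funM.
  by move=> x; rewrite mule_ge0.
pose H z := \int[mW]_y (e y * h (z + y)%R).
have mH2 : measurable_fun setT (fun x : R * R => e x.2 * h (x.1 + x.2)%R).
  apply: emeasurable_funM; first exact: measurableT_comp.
  exact: measurableT_comp.
have H0 z : 0 <= H z by apply: integral_ge0 => y _; rewrite mule_ge0.
have mH : measurable_fun setT H.
  apply: (@measurable_fun_fubini_tonelli_F _ _ _ _ _ mW
    (fun x : R * R => e x.2 * h (x.1 + x.2)%R)) => //.
  by move=> x; rewrite mule_ge0.
rewrite (@indep_integral2 (fun x => h ((x.1 + x.2) / r)%R))//=; last first.
  exact: measurableT_comp (measurableT_comp mh mV) mD.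
rewrite (@indep_integral2 (fun x => e (x.1 + x.2)%R * h (x.1 + x.2)%R))//=;
  last 2 first.
- by apply: emeasurable_funM; exact: measurableT_comp.
- by move=> x; rewrite mule_ge0.
(* First [W] is rescaled at fixed [z], with the shifted test function sending [y] to
   [h (z / r + y)]. The result depends on [z / r] through [H], which then serves as test function
   for [Z]. *)
transitivity (\int[mZ]_z ((r `^ b)%:E * H (z / r)%R)).
  apply: eq_integral => z _; rewrite /H -(scW (fun y => h (z / r + y)%R)) => //.
    by apply: eq_integral => y _; rewrite mulrDl.
  by apply: measurableT_comp mh _; exact: measurable_funD.
have mHV : measurable_fun setT (fun z : R => H (z / r)%R).
  exact: measurableT_comp mV.
rewrite ge0_integralZl; [|by []|exact: mHV|by move=> z _; exact: H0
  |by rewrite lee_fin powR_ge0].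
rewrite (scZ _ mH H0) muleA -EFinM mulrC -powRD; last first.
  by rewrite (gt_eqF r0) implybT.
congr (_ * _); apply: eq_integral => z _.
rewrite -ge0_integralZl//.
- by apply: eq_integral => y _; rewrite eD muleA.
- apply: emeasurable_funM => //.
  by apply: measurableT_comp mh _; exact: measurable_funD.
- by move=> y _; rewrite mule_ge0.
Qed.

End sum2.

Definition mk_rv (d : measure_display) (T : measurableType d) (R : realType)
    (P : probability T R) (f : T -> R) (mf : measurable_fun setT f) :
  {RV P >-> R} := mfun_Sub (mem_set mf).

(** * Partial sums of an independent family *)

Section indep_sum.
Local Open Scope ereal_scope.
Context (d : measure_display) (T : measurableType d) (R : realType)
  (P : probability T R).

(** The hypotheses describe the law of the pair, and its restriction to [E], on rectangles only;
    uniqueness of product measures carries the factorisation to the non-rectangular set [C] where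
    the coordinates add up to a point of [A]. *)
Lemma indep_event_add (Z W : {RV P >-> R}) (E : set T) (A : set R) :
  measurable E -> measurable A ->
  (forall A B : set R, measurable A -> measurable B ->
    P (Z @^-1` A `&` W @^-1` B) = P (Z @^-1` A) * P (W @^-1` B)) ->
  (forall A B : set R, measurable A -> measurable B ->
    P (Z @^-1` A `&` W @^-1` B `&` E) =
    P (Z @^-1` A) * P (W @^-1` B) * P E) ->
  P ((Z \+ W)%R @^-1` A `&` E) = P ((Z \+ W)%R @^-1` A) * P E.
Proof.
move=> mE mA ZW ZWE.
have mZW : measurable_fun setT (fun w => (Z w, W w)).
  exact: measurable_fun_pair.
have mD : measurable_fun setT (fun x : R * R => (x.1 + x.2)%R).
  exact: measurable_funD.
pose C : set (R * R) := (fun x => (x.1 + x.2)%R) @^-1` A.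
have mC : measurable C by rewrite -[C]setTI; exact: mD.
have f0 : (0 <= fine (P E))%R by rewrite fine_ge0.
have fE : (fine (P E))%:E = P E by rewrite fineK// fin_num_measure.
pose f := NngNum f0.
pose mZ := distribution P Z; pose mW := distribution P W.
pose m : {measure set (R * R) -> \bar R} := pushforward P (fun w => (Z w, W w)).
pose mr : {measure set (R * R) -> \bar R} :=
  pushforward (mrestr P mE) (fun w => (Z w, W w)).
pose ms : {measure set (R * R) -> \bar R} := mscale f (mZ \x mW).
(* The product of [mZ] with [mW] scaled by [P E] is compared on rectangles with the restricted joint
   law, then with the scaled product law. *)
have H1 : (mZ \x mscale f mW) C = mr mZW C.
  apply: product_measure_unique => // A' B' mA' mB'.
  by rewrite /mr /= /pushforward /mrestr /mscale/= fE muleCA muleC -ZWE.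
have H2 : (mZ \x mscale f mW) C = ms C.
  apply: product_measure_unique => // A' B' mA' mB'.
  by rewrite /ms /= /mscale/= product_measure1E// muleCA.
have H3 : (mZ \x mW) C = m mZW C by apply: product_measure_unique.
by move: H1; rewrite H2 /ms/= /mscale/= fE H3 muleC => ->.
Qed.

Variables (n : nat) (X : 'I_n -> {RV P >-> R}).
Hypothesis indX : mutually_independent X.

(** Filtering a fixed index type keeps all partial sums over the same ['I_n] during the induction on
    [m]. *)
Definition psum m w : R := (\sum_(i < n | (i < m)%N) X i w)%R.

Lemma measurable_psum m : measurable_fun setT (psum m).
Proof.
rewrite /psum; under eq_fun do rewrite big_mkcond/=.
by apply: measurable_sum => i; case: (i < m)%N.
Qed.

Lemma psum0 : psum 0 = cst 0%R.
Proof. by apply/funext => w; rewrite /psum big_pred0. Qed.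

Lemma psumS m (mn : (m < n)%N) : psum m.+1 = (psum m \+ X (Ordinal mn))%R.
Proof.
apply/funext => w; rewrite /psum (bigD1 (Ordinal mn))/= ?ltnSn// addrC.
congr (_ + _)%R; apply: eq_bigl => i.
by rewrite ltnS ltn_neqAle andbC -val_eqE.
Qed.

Let event (B : 'I_n -> set R) := \bigcap_(i in [set: 'I_n]) (X i @^-1` B i).

Let measurable_event B : (forall i, measurable (B i)) -> measurable (event B).
Proof.
move=> mB; apply: fin_bigcap_measurable => // i _; exact: measurable_funPTI.
Qed.

Let set_at (B : 'I_n -> set R) j D i := if i == j then D else B i.

Let event_set_at (B : 'I_n -> set R) j D :
  B j = setT -> event (set_at B j D) = X j @^-1` D `&` event B.
Proof.
move=> Bj; apply/seteqP; split => [w eB|w [Dw eB] i _]; rewrite /set_at.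
  split; first by have := eB j I; rewrite /set_at/= eqxx.
  move=> i _; have := eB i I; rewrite /set_at/=; case: eqP => [->|//].
  by rewrite Bj.
by rewrite /=; case: eqP => [->//|_]; exact: eB.
Qed.

Let P_event_set_at (B : 'I_n -> set R) j D : (forall i, measurable (B i)) ->
  measurable D -> B j = setT ->
  P (event (set_at B j D)) = P (X j @^-1` D) * P (event B).
Proof.
move=> mB mD Bj; rewrite /event !indX//; last first.
  by move=> i; rewrite /set_at; case: ifP.
rewrite (bigD1 j)//= [in RHS](bigD1 j)//= /set_at eqxx Bj preimage_setT.
rewrite probability_setT mul1e; congr (_ * _).
by apply: eq_bigr => i /negbTE ->.
Qed.

(** The induction needs independence from all remaining variables jointly, not just from the next
    one: [B] is trivial below [m] and arbitrary from [m] on. *)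
Let psum_event m : (m <= n)%N -> forall (A : set R) (B : 'I_n -> set R),
  measurable A -> (forall i, measurable (B i)) ->
  (forall i : 'I_n, (i < m)%N -> B i = setT) ->
  P (psum m @^-1` A `&` event B) = P (psum m @^-1` A) * P (event B).
Proof.
elim: m => [|m IH] mn A B mA mB BT.
  rewrite psum0 preimage_cst; case: ifPn => _.
    by rewrite setTI probability_setT mul1e.
  by rewrite set0I measure0 mul0e.
have eT : event (fun=> setT) = setT.
  by apply/seteqP; split => // w _ i _.
pose j := Ordinal mn.
pose Z : {RV P >-> R} := mk_rv P (measurable_psum m).
have ZX B' A' D : (forall i, measurable (B' i)) -> measurable A' ->
    measurable D -> (forall i : 'I_n, (i < m.+1)%N -> B' i = setT) ->
    P (Z @^-1` A' `&` X j @^-1` D `&` event B') =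
    P (Z @^-1` A') * P (X j @^-1` D) * P (event B').
  move=> mB' mA' mD B'T.
  (* The condition on [X j] is absorbed into the event as its [j]-th set, which the induction
     hypothesis at [m] leaves free. *)
  rewrite -setIA -event_set_at; last by apply: B'T => /=.
  rewrite -muleA -P_event_set_at//; last by apply: B'T => /=.
  apply: IH => //; first exact: ltnW.
    by move=> i; rewrite /set_at; case: ifP.
  move=> i im; rewrite /set_at; case: eqP => [ij|_].
    by move: im; rewrite ij/= ltnn.
  by apply: B'T; exact: ltnW.
rewrite (psumS mn); apply: (@indep_event_add Z (X j)) => //.
- exact: measurable_event.
- move=> A' D mA' mD; have := ZX (fun=> setT) A' D.
  by rewrite eT setIT probability_setT mule1; apply.
- by move=> A' D mA' mD; exact: ZX.
Qed.

Lemma psum_indep m (mn : (m < n)%N) (A B : set R) :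
  measurable A -> measurable B ->
  P (psum m @^-1` A `&` X (Ordinal mn) @^-1` B) =
  P (psum m @^-1` A) * P (X (Ordinal mn) @^-1` B).
Proof.
move=> mA mB; set j := Ordinal mn.
have eT : event (fun=> setT) = setT.
  by apply/seteqP; split => // w _ i _.
have <- : event (set_at (fun=> setT) j B) = X j @^-1` B.
  by rewrite event_set_at// eT setIT.
apply: psum_event => //; first exact: ltnW.
  by move=> i; rewrite /set_at; case: ifP.
move=> i im; rewrite /set_at; case: eqP => // ij.
by move: im; rewrite ij/= ltnn.
Qed.

Lemma psum_exp_scaling (theta a : R) m : (m <= n)%N ->
  (forall i, exp_scaling P theta a (X i)) ->
  exp_scaling P theta (a * m%:R)%R (psum m).
Proof.
move=> + sX; elim: m => [_|m IH mn].
  rewrite psum0 => r h r0 mh h0 /=.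
  rewrite mulr0 powRr0 mul1e; apply: eq_integral => w _.
  by rewrite !mulr0 !mul0r expR0 mul1e.
rewrite (psumS mn) -[m.+1]addn1 natrD mulrDr mulr1.
apply: (@exp_scalingD _ _ _ _ (mk_rv P (measurable_psum m))) => //.
- by move=> A B mA mB; exact: psum_indep.
- exact: IH (ltnW mn).
Qed.

End indep_sum.

(** * The tail bound from the change of measure *)

Section tail.
Local Open Scope ereal_scope.
Context (d : measure_display) (T : measurableType d) (R : realType)
  (P : probability T R) (theta a : R) (Z : {RV P >-> R}).
Hypotheses (theta0 : (0 < theta)%R) (sZ : exp_scaling P theta a Z).

(** With the indicator of [D] as test function, the weight on [D] is at most its value at [c]. The
    condition on [D] covers the lower half-line at [c] for [r <= 1] and the upper one for
    [r >= 1]. *)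
Lemma exp_scaling_tail (r c : R) (D : set R) : (0 < r)%R -> measurable D ->
  (forall x, D x -> (1 - r) * x <= (1 - r) * c)%R ->
  P [set w | D (Z w / r)%R] <=
  (r `^ a * expR ((1 - r) * c / theta))%:E * P [set w | D (Z w)].
Proof.
move=> r0 mD Dc.
have mZ : measurable_fun setT Z by [].
have mZr : measurable_fun setT (fun w => Z w / r)%R by exact: measurable_funM.
have mDZ : measurable [set w | D (Z w)].
  by rewrite -[X in measurable X]setTI; exact: mZ.
have mDZr : measurable [set w | D (Z w / r)%R].
  by rewrite -[X in measurable X]setTI; exact: mZr.
have -> : P [set w | D (Z w / r)%R] = \int[P]_w (\1_D (Z w / r)%R)%:E.
  by rewrite -[RHS]/(\int[P]_w (\1_[set w | D (Z w / r)%R] w)%:E)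
    integral_indic// setIT.
have mI : measurable_fun setT (fun x : R => (\1_D x : R)%:E).
  exact/measurable_EFinP.
rewrite (sZ r0 mI)//.
rewrite EFinM -muleA lee_wpmul2l ?lee_fin ?powR_ge0//.
have -> : P [set w | D (Z w)] = \int[P]_w (\1_D (Z w))%:E.
  by rewrite -[RHS]/(\int[P]_w (\1_[set w | D (Z w)] w)%:E)
    integral_indic// setIT.
have mIZ : measurable_fun setT (fun w => (\1_D (Z w) : R)%:E).
  exact: measurableT_comp mI mZ.
have me : measurable_fun setT (fun w => (expR ((1 - r) * Z w / theta))%:E).
  apply/measurable_EFinP; apply: measurableT_comp => //.
  by apply: measurable_funM => //; exact: measurable_funM.
rewrite -ge0_integralZl//.
apply: ge0_le_integral => //.
- exact: emeasurable_funM.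
- exact: emeasurable_funM.
- move=> w _; rewrite -!EFinM lee_fin indicE.
  case: (boolP (Z w \in D)) => [/set_mem DZ|_]; last by rewrite !mulr0.
  by rewrite !mulr1 ler_expR ler_pM2r ?invr_gt0// Dc.
Qed.

End tail.

(** * Real inequalities for the limit as [r] decreases to 1 *)

Section elementary.
Context (R : realType).
Implicit Types x y b s r v : R.

Lemma ler_mul_gt1 x y : 0 <= y -> (forall q, 1 < q -> x <= q * y) -> x <= y.
Proof.
move=> y0 xy; apply/ler_addgt0Pr => e e0.
have y1 : 0 < y + 1 by rewrite ltr_wpDl.
(* The excess [e * y / (y + 1)] is at most [e]; adding 1 in the denominator covers [y = 0]. *)
have := xy (1 + e / (y + 1)); rewrite ltrDl divr_gt0// => /(_ isT) /le_trans.
apply; rewrite mulrDl mul1r lerD2l mulrAC ler_pdivrMr// ler_pM2l//.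
by rewrite lerDl.
Qed.

(** Combines [exp t >= 1 + t] at [t = b ln r] with [ln r >= 1 - 1 / r]. *)
Lemma powR_sub1_ge r b : 0 <= b -> 1 < r -> b * ((r - 1) / r) <= r `^ b - 1.
Proof.
move=> b0 r1; have r0 : 0 < r by rewrite (lt_trans ltr01).
rewrite lerBrDl.
have -> : r `^ b = expR (b * ln r) by rewrite /powR gt_eqF.
apply: le_trans (expR_ge1Dx _); rewrite lerD2l ler_wpM2l//.
rewrite -[ln r]opprK -lnV// lerNr.
have h : - ((r - 1) / r) = r^-1 - 1 by rewrite mulrBl mul1r mulfV ?gt_eqF// opprB.
have := @le_ln1Dx R (r^-1 - 1); rewrite h [1 + _]addrC subrK; apply.
by rewrite ltrBrDl subrr invr_gt0.
Qed.

(** Combines [exp t >= 1 + t] at [t = - b ln r] with [ln r <= r - 1]. *)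
Lemma sub1_powR_le r b : 0 <= b -> 1 < r -> 1 - (r `^ b)^-1 <= b * (r - 1).
Proof.
move=> b0 r1; have r0 : 0 < r by rewrite (lt_trans ltr01).
have -> : (r `^ b)^-1 = expR (- (b * ln r)) by rewrite expRN /powR gt_eqF.
rewrite lerBlDl -lerBlDr; apply: le_trans (expR_ge1Dx _).
rewrite lerD2l lerN2 ler_wpM2l//.
rewrite -[in leLHS](subrK 1 r) addrC; apply: le_ln1Dx.
by rewrite ltrBrDl subrr.
Qed.

(* The hypotheses compare [1 - exp(-s x)] with [s x] and [s x exp(-s x)] under the
   expectation, with [s = (r - 1) / theta]; both bounds collapse as [r] tends to [1]. *)
Lemma moment_squeeze theta b v v' : 0 < theta -> 0 < b -> 0 <= v -> 0 <= v' ->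
  (forall r, 1 < r ->
    v <= (r `^ b)^-1 * v + (r - 1) / theta * v' /\
    (r `^ b)^-1 * v + (r - 1) / theta * ((r `^ (b + 1))^-1 * v') <= v) ->
  v' = theta * b * v.
Proof.
move=> t0 b0 v0 v'0 H.
have b1 : 0 < b + 1 by rewrite addr_gt0.
have u0 : 0 <= theta * b * v by rewrite !mulr_ge0 ?(ltW t0) ?(ltW b0).
have K q : 1 < q -> v' <= q * (theta * b * v) /\ theta * b * v <= q * v'.
  move=> q1; have q0 : 0 < q by rewrite (lt_trans ltr01).
  (* This choice makes the loss exactly [q] in both directions: as the factor [r^(b+1)] on [v'] in
     one, and as [r^b * r] in the lower bound of [1 - r^(-b)] in the other. *)
  pose r := q `^ (b + 1)^-1.
  have qr : r `^ (b + 1) = q.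
    by rewrite /r -powRrM mulVf ?gt_eqF// powRr1// ltW.
  have r0 : 0 < r by rewrite powR_gt0.
  have r1 : 1 < r.
    rewrite /r /powR gt_eqF// -[ltLHS]expR0 ltr_expR mulr_gt0 ?invr_gt0//.
    exact: ln_gt0.
  have s0 : 0 < r - 1 by rewrite subr_gt0.
  have [H1 H2] := H _ r1; rewrite qr in H2.
  have rb0 : 0 < r `^ b by rewrite powR_gt0.
  have E1 := powR_sub1_ge (ltW b0) r1.
  have E2 := sub1_powR_le (ltW b0) r1.
  have qE : q = r `^ b * r by rewrite -qr powRD ?powRr1 ?(gt_eqF b1)// ltW.
  split.
    have : (r - 1) / theta * (q^-1 * v') <= b * (r - 1) * v.
      apply: (@le_trans _ _ ((1 - (r `^ b)^-1) * v)); last exact: ler_wpM2r.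
      by rewrite [leRHS]mulrBl mul1r lerBrDl.
    have -> : (r - 1) / theta * (q^-1 * v') = (r - 1) * (v' / (q * theta)).
      by field; rewrite !gt_eqF.
    have -> : b * (r - 1) * v = (r - 1) * (b * v) by ring.
    rewrite ler_pM2l// ler_pdivrMr ?mulr_gt0//.
    by have -> : b * v * (q * theta) = q * (theta * b * v) by ring.
  have E3 : b * (r - 1) / q <= 1 - (r `^ b)^-1.
    rewrite ler_pdivrMr// qE.
    have -> : (1 - (r `^ b)^-1) * (r `^ b * r) = (r `^ b - 1) * r.
      by field; rewrite gt_eqF.
    by move: E1; rewrite mulrA ler_pdivrMr.
  have : b * (r - 1) / q * v <= (r - 1) / theta * v'.
    apply: le_trans (_ : (1 - (r `^ b)^-1) * v <= _); first exact: ler_wpM2r.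
    by rewrite [leLHS]mulrBl mul1r lerBlDl.
  have -> : b * (r - 1) / q * v = (r - 1) * (b * v / q) by ring.
  have -> : (r - 1) / theta * v' = (r - 1) * (v' / theta) by ring.
  rewrite ler_pM2l// ler_pdivrMr// mulrAC ler_pdivlMr//.
  have -> : b * v * theta = theta * b * v by ring.
  by rewrite [q * _]mulrC.
apply/eqP; rewrite eq_le; apply/andP; split; apply: ler_mul_gt1 => // q q1.
  exact: (K q q1).1.
exact: (K q q1).2.
Qed.

End elementary.

(* Truncation to [x > 0] makes [x^j] an admissible nonnegative test function; gamma
   variables are almost surely positive. *)
Definition pospow (R : realType) (j : nat) (x : R) : R :=
  if 0 < x then x ^+ j else 0.

(** * Recursion for the moments from the scaling identity *)

Section moments.
Context (d : measure_display) (T : measurableType d) (R : realType)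
  (P : probability T R) (theta a : R) (Z : {RV P >-> R}).
Hypotheses (theta0 : 0 < theta) (a0 : 0 < a) (sZ : exp_scaling P theta a Z).

Lemma pospow_ge0 j (x : R) : 0 <= pospow j x.
Proof. by rewrite /pospow; case: ifPn => // x0; rewrite exprn_ge0// ltW. Qed.

Lemma measurable_pospow j : measurable_fun setT (@pospow R j).
Proof.
by apply: measurable_fun_ifT => //; exact: measurable_fun_ltr.
Qed.

Lemma pospowV j (x r : R) : 0 < r -> pospow j (x / r) = (r ^+ j)^-1 * pospow j x.
Proof.
move=> r0; rewrite /pospow pmulr_lgt0 ?invr_gt0//.
by case: ifPn => _; rewrite ?mulr0// expr_div_n mulrC.
Qed.

(** This bound and [pospow_ge] both multiply [1 + t <= exp t] by a nonnegative factor, with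
    [t = - s x] here and [t = s x] there. *)
Lemma pospow_le j (x s : R) : 0 <= s ->
  pospow j x <= expR (- s * x) * pospow j x + s * pospow j.+1 x.
Proof.
move=> s0; rewrite /pospow; case: ifPn => x0; last by rewrite !mulr0 addr0.
rewrite exprS mulrA -mulrDl ler_peMl ?exprn_ge0 ?(ltW x0)//.
by rewrite -lerBlDr -mulNr expR_ge1Dx.
Qed.

Lemma pospow_ge j (x s : R) : 0 <= s ->
  expR (- s * x) * pospow j x + s * (expR (- s * x) * pospow j.+1 x) <=
  pospow j x.
Proof.
move=> s0; rewrite /pospow; case: ifPn => x0; last by rewrite !mulr0 addr0.
rewrite exprS [_ * (x * _)]mulrA mulrA -mulrDl ler_piMl ?exprn_ge0 ?(ltW x0)//.
have -> : expR (- s * x) + s * (expR (- s * x) * x) =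
  expR (- s * x) * (1 + s * x) by ring.
rewrite mulNr expRN mulrC ler_pdivrMr ?expR_gt0// mul1r.
exact: expR_ge1Dx.
Qed.

Let M j := (\int[P]_w (pospow j (Z w))%:E)%E.
Let N r j := (\int[P]_w (expR ((1 - r) * Z w / theta) * pospow j (Z w))%:E)%E.

Let mpw j : measurable_fun setT (fun w => (pospow j (Z w))%:E).
Proof.
by apply/measurable_EFinP; apply: measurableT_comp => //; exact: measurable_pospow.
Qed.

Let mepw r j : measurable_fun setT
  (fun w => (expR ((1 - r) * Z w / theta) * pospow j (Z w))%:E).
Proof.
apply/measurable_EFinP; apply: measurable_funM.
  apply: measurableT_comp => //; apply: measurable_funM => //.
  exact: measurable_funM.
by apply: measurableT_comp => //; exact: measurable_pospow.
Qed.

(** This is [exp_scaling] for the test function [pospow j], whose homogeneity contributes the extra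
    [r^(-j)]. *)
Let NE r j : 0 < r -> N r j = ((r `^ (a + j%:R))^-1%:E * M j)%E.
Proof.
move=> r0.
have mh : measurable_fun setT (fun x : R => (pospow j x)%:E).
  by apply/measurable_EFinP; exact: measurable_pospow.
have h0 (x : R) : (0 <= (pospow j x)%:E)%E.
  by rewrite lee_fin; exact: pospow_ge0.
have := sZ r0 mh h0.
under eq_integral do rewrite pospowV// EFinM.
rewrite ge0_integralZl//; last first.
  by rewrite lee_fin invr_ge0 exprn_ge0// ltW.
under [in RHS]eq_integral do rewrite -EFinM.
rewrite -/(N r j) -/(M j) => H.
have ra0 : 0 < r `^ a by rewrite powR_gt0.
rewrite powRD ?(gt_eqF r0) ?implybT// powR_mulrn ?(ltW r0)// invfM EFinM -muleA.
by rewrite H muleA -EFinM mulVf ?gt_eqF// mul1e.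
Qed.

(** Integrating [pospow_le] and [pospow_ge] at [s = (r - 1) / theta], and removing the weights by
    [NE], gives the two hypotheses of [moment_squeeze] with [b = a + j]. *)
Lemma exp_scaling_moment j (v : R) : M j = v%:E ->
  M j.+1 = (theta * (a + j%:R) * v)%:E.
Proof.
move=> Mv.
have b0 : 0 < a + j%:R by rewrite ltr_wpDr.
have pw0 i w : (0 <= (pospow i (Z w))%:E)%E by rewrite lee_fin pospow_ge0.
have epw0 r i w :
    (0 <= (expR ((1 - r) * Z w / theta) * pospow i (Z w))%:E)%E.
  by rewrite lee_fin mulr_ge0 ?pospow_ge0 ?expR_ge0.
have M0 i : (0 <= M i)%E by apply: integral_ge0.
have v0 : 0 <= v by rewrite -lee_fin -Mv.
have eE r w : (1 - r) * Z w / theta = - ((r - 1) / theta) * Z w.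
  by rewrite mulNr -opprB !mulNr mulrAC.
have up r : 1 < r -> (M j <= N r j + ((r - 1) / theta)%:E * M j.+1)%E.
  move=> r1; have s0 : 0 <= (r - 1) / theta by rewrite divr_ge0 ?subr_ge0 ?ltW.
  rewrite /N /M -ge0_integralZl// -ge0_integralD//; last 2 first.
  - by move=> w _; rewrite mule_ge0.
  - by apply: emeasurable_funM.
  apply: ge0_le_integral => //.
    by apply: emeasurable_funD => //; exact: emeasurable_funM.
  by move=> w _; rewrite -EFinM -EFinD lee_fin eE pospow_le.
have lo r : 1 < r -> (N r j + ((r - 1) / theta)%:E * N r j.+1 <= M j)%E.
  move=> r1; have s0 : 0 <= (r - 1) / theta by rewrite divr_ge0 ?subr_ge0 ?ltW.
  rewrite /N /M -ge0_integralZl// -ge0_integralD//; last 2 first.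
  - by move=> w _; rewrite mule_ge0.
  - by apply: emeasurable_funM.
  apply: ge0_le_integral => //.
  - by move=> w _; rewrite adde_ge0// mule_ge0.
  - by apply: emeasurable_funD => //; exact: emeasurable_funM.
  by move=> w _; rewrite -EFinM -EFinD lee_fin eE pospow_ge.
have Sj : a + j.+1%:R = a + j%:R + 1 by rewrite -natr1 addrA.
(* An infinite next moment would make the left side of the lower inequality infinite, while [M j] is
   finite; the value [r = 2] is an arbitrary choice above 1. *)
have Mfin : M j.+1 \is a fin_num.
  have r1 : (1 : R) < 2 by rewrite ltr1n.
  have := lo 2 r1; rewrite !NE// Mv ge0_fin_numE// => lo2.
  rewrite ltey; apply/eqP => My; move: lo2; rewrite My.
  rewrite !gt0_muley ?lte_fin ?divr_gt0 ?invr_gt0 ?powR_gt0//.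
pose v' := fine (M j.+1).
have Mv' : M j.+1 = v'%:E by rewrite fineK.
rewrite Mv'; congr EFin; apply: moment_squeeze => //.
  by rewrite -lee_fin -Mv'.
move=> r r1; have r0 : 0 < r by rewrite (lt_trans ltr01).
move: (up r r1) (lo r r1); rewrite !NE// Mv Mv' -!EFinM -!EFinD !lee_fin Sj.
by [].
Qed.

End moments.

(** * Calculus of expectations and the raw gamma moments *)

Section expectations.
Local Open Scope ereal_scope.
Context (d : measure_display) (T : measurableType d) (R : realType)
  (P : probability T R).
Implicit Types (f g : T -> R) (u v : R).

(** Integrability is bundled with the value so that polynomials can be integrated by linearity
    without side conditions. *)
Definition has_expectation f v :=
  P.-integrable setT (EFin \o f) /\ \int[P]_w (f w)%:E = v%:E.

Lemma has_expectationD f g u v : has_expectation f u -> has_expectation g v ->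
  has_expectation (f \+ g)%R (u + v)%R.
Proof.
move=> [fi fu] [gi gv]; split.
  by rewrite (_ : EFin \o _ = (EFin \o f) \+ (EFin \o g))//; exact: integrableD.
by rewrite EFinD -fu -gv -integralD_EFin.
Qed.

Lemma has_expectationZ (c : R) f v : has_expectation f v ->
  has_expectation (fun w => c * f w)%R (c * v)%R.
Proof.
move=> [fi fv]; split.
  by rewrite (_ : EFin \o _ = fun w => c%:E * (EFin \o f) w)//; exact: integrableZl.
by under eq_integral do rewrite EFinM; rewrite integralZl// fv.
Qed.

Lemma has_expectation_cst (c : R) : has_expectation (cst c) c.
Proof.
split; first exact: finite_measure_integrable_cst.
by have := expectation_cst P c; rewrite unlock.
Qed.

Lemma has_expectation_eq f g u v : has_expectation f u -> f =1 g -> u = v ->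
  has_expectation g v.
Proof. by move=> fu /funext <- <-. Qed.

(** The recursion [exp_scaling_moment] starts from total mass 1 at [j = 0] and yields the rising
    factorial of [k]. *)
Lemma gamma_moment (k theta : R) (X : {RV P >-> R}) j : (0 < k)%R ->
  (0 < theta)%R -> gamma_distributed k theta X ->
  has_expectation (fun w => X w ^+ j)%R
    (theta ^+ j * \prod_(i < j) (k + i%:R))%R.
Proof.
move=> k0 t0 gX.
have sX := gamma_exp_scaling k0 gX.
have mneg : measurable [set w | (X w <= 0)%R].
  have -> : [set w | (X w <= 0)%R] = X @^-1` `]-oo, 0%R]%classic.
    by apply/seteqP; split => w /=; rewrite in_itv.
  exact: measurable_funPTI.
(* Almost sure positivity lets the truncated power replace the true one under the integral. *)
have aeX : {ae P, forall w, (0 < X w)%R}.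
  exists [set w | (X w <= 0)%R]; split => //; first exact: gamma_le0 gX.
  by move=> w /=; rewrite leNgt => /negP.
have pj : \int[P]_w (pospow j (X w))%:E =
    (theta ^+ j * \prod_(i < j) (k + i%:R))%:E.
  elim: j => [|j IH].
    rewrite big_ord0 expr0 mulr1.
    rewrite (@ae_eq_integral _ _ _ P _ (cst 1))//; first last.
    - by apply: filterS aeX => w Xw _ /=; rewrite /pospow Xw expr0.
    - by apply/measurable_EFinP; apply: measurableT_comp => //; exact: measurable_pospow.
    by rewrite integral_cst// mul1e; exact: probability_setT.
  rewrite (exp_scaling_moment t0 k0 sX IH); congr EFin.
  by rewrite big_ord_recr/= exprS; ring.
have mX : measurable_fun setT (fun w => (X w ^+ j)%:E).
  by apply/measurable_EFinP; exact: measurable_funX.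
have mp : measurable_fun setT (fun w => (pospow j (X w))%:E).
  by apply/measurable_EFinP; apply: measurableT_comp => //; exact: measurable_pospow.
split; last first.
  rewrite -pj; apply: ae_eq_integral => //.
  by apply: filterS aeX => w Xw _ /=; rewrite /pospow Xw.
apply/integrableP; split => //.
rewrite (@ae_eq_integral _ _ _ P _ (fun w => (pospow j (X w))%:E))//.
- by rewrite pj ltry.
- exact: measurableT_comp.
- by apply: filterS aeX => w Xw _ /=; rewrite /pospow Xw ger0_norm// exprn_ge0// ltW.
Qed.

End expectations.

(** * Ingredients for Berry-Esseen at the origin: the value of [Phi] and the third moment *)

Lemma Phi0 (R : realType) : Phi (0 : R) = 1 / 2.
Proof.
have n10 : (1 : R) != 0 by rewrite oner_neq0.
have evenpdf : normal_pdf (0 : R) 1 =1 normal_pdf 0 1 \o -%R.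
  by move=> x; rewrite /= normal_pdfE// /normal_fun !subr0 sqrrN.
have mpdf : measurable_fun setT (fun x : R => (normal_pdf 0 1 x)%:E).
  by apply/measurable_EFinP; exact: measurable_normal_pdf.
(* Evenness makes the total mass 1 twice the mass of a half-line. *)
have := ge0_symfun_integralT (@normal_pdf_ge0 R 0 1) (@continuous_normal_pdf R 0 1 n10) evenpdf.
rewrite integral_normal_pdf//.
have -> : [set x : R | 0 <= x] = `[0, +oo[%classic.
  by apply/seteqP; split => x /=; rewrite in_itv/= andbT.
rewrite (ge0_integration_by_substitution0 mpdf); last first.
  by move=> x; rewrite lee_fin normal_pdf_ge0.
under eq_integral => x _ do rewrite -[normal_pdf 0 1 (- x)]/((normal_pdf 0 1 \o -%R) x) -evenpdf.
rewrite /Phi; set I := (\int[_]_(x in _) _)%E.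
have I0 : (0 <= I)%E by apply: integral_ge0 => x _; rewrite lee_fin normal_pdf_ge0.
(* [Phi] is defined through [fine], so infinite values of the integral have to be excluded; they
   contradict its double being 1 or its sign. *)
move: I I0 => [r| |]//= r0; last by rewrite gt0_muley// lte_fin.
by rewrite -EFinM => -[H]; lra.
Qed.

Section third_moment.
Context (d : measure_display) (T : measurableType d) (R : realType)
  (P : probability T R).

(** The right side exceeds the left by [z^2 (z - b)^2 / (2 b)] with [z] the absolute value of
    [y]. *)
Lemma cube_norm_le (b y : R) : 0 < b ->
  `|y| ^+ 3 <= b / 2 * y ^+ 2 + (2 * b)^-1 * y ^+ 4.
Proof.
move=> b0; rewrite -[y ^+ 2]real_normK ?num_real//.
have -> : y ^+ 4 = `|y| ^+ 4 by rewrite -normrX ger0_norm// exprn_even_ge0.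
set z := `|y|; have z0 : 0 <= z by exact: normr_ge0.
have -> : b / 2 * z ^+ 2 + (2 * b)^-1 * z ^+ 4 =
    z ^+ 3 + z ^+ 2 * (z - b) ^+ 2 / (2 * b).
  by field; rewrite gt_eqF.
by rewrite lerDl divr_ge0//; [rewrite mulr_ge0 ?sqr_ge0|rewrite mulr_ge0// ltW].
Qed.

(** This is the Cauchy-Schwarz bound of the third absolute moment by the second and fourth, obtained
    by integrating [cube_norm_le]. *)
Lemma third_moment_le (Y : T -> R) (s2 kappa : R) :
  measurable_fun setT Y -> 0 < s2 -> 0 < kappa ->
  has_expectation P (fun w => Y w ^+ 2) s2 ->
  has_expectation P (fun w => Y w ^+ 4) (kappa * s2 ^+ 2) ->
  (\int[P]_w (`|Y w| ^+ 3)%:E <= (Num.sqrt kappa * Num.sqrt s2 ^+ 3)%:E)%E.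
Proof.
move=> mY s0 k0 Y2 Y4.
set s := Num.sqrt s2; set t := Num.sqrt kappa.
have s_gt0 : 0 < s by rewrite sqrtr_gt0.
have t_gt0 : 0 < t by rewrite sqrtr_gt0.
have s2E : s2 = s ^+ 2 by rewrite sqr_sqrtr// ltW.
have kE : kappa = t ^+ 2 by rewrite sqr_sqrtr// ltW.
have b0 : 0 < t * s by rewrite mulr_gt0.
(* The parameter [b = t * s] minimises the integrated bound. *)
have [iG EG] := has_expectationD (has_expectationZ (t * s / 2) Y2)
  (has_expectationZ (2 * (t * s))^-1 Y4).
have -> : t * s ^+ 3 = t * s / 2 * s2 + (2 * (t * s))^-1 * (kappa * s2 ^+ 2).
  by rewrite s2E kE; field; rewrite !gt_eqF.
rewrite -EG; apply: ge0_le_integral => //.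
- apply/measurable_EFinP; apply: measurable_funX.
  exact: measurableT_comp.
- exact: measurable_int iG.
- by move=> w _; rewrite lee_fin; exact: cube_norm_le.
Qed.

End third_moment.

(** * Berry-Esseen at the origin with a fourth-moment error *)

Section berry_esseen.
Context (d : measure_display) (T : measurableType d) (R : realType)
  (P : probability T R).

(** Here [kappa] is the kurtosis of [Y], and [third_moment_le] bounds the Berry-Esseen ratio by its
    square root. *)
Lemma berry_esseen_sum_le0 (C : R) (n : nat) (Ys : 'I_n -> {RV P >-> R})
    (Y : {RV P >-> R}) (s2 kappa : R) :
  0 < C -> berry_esseen_constant C -> (0 < n)%N ->
  mutually_independent Ys -> (forall i, same_distribution (Ys i) Y) ->
  0 < s2 -> 0 < kappa ->
  has_expectation P Y 0 ->
  has_expectation P (fun w => Y w ^+ 2) s2 ->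
  has_expectation P (fun w => Y w ^+ 4) (kappa * s2 ^+ 2) ->
  (P [set w | (\sum_(i < n) Ys i w <= 0)%R] <=
   (1 / 2 + C / Num.sqrt n%:R * Num.sqrt kappa)%:E)%E.
Proof.
move=> C0 HC n0 ind same s0 k0 Y1 Y2 Y4.
have mY : measurable_fun setT Y by [].
have Y3 := third_moment_le mY s0 k0 Y2 Y4.
set s := Num.sqrt s2 in Y3 *.
have s_gt0 : 0 < s by rewrite sqrtr_gt0.
have E1 : expectation P Y = 0%E by rewrite unlock Y1.2.
have E2 : expectation P (fun w => Y w ^+ 2) = s2%:E by rewrite unlock Y2.2.
have E3 : (expectation P (fun w => (`|Y w| ^+ 3)%R) <=
  (Num.sqrt kappa * s ^+ 3)%R%:E)%E by rewrite unlock.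
have E30 : (0 <= expectation P (fun w => (`|Y w| ^+ 3)%R))%E.
  by apply: expectation_ge0 => w; rewrite exprn_ge0.
have := @HC d T P Y E1; rewrite E2 lte_fin => /(_ s0).
move=> /(_ (le_lt_trans E3 (ltry _)) n Ys n0 ind same 0).
rewrite Phi0 /=.
(* At threshold 0 the positive normalisation drops out. *)
have -> : [set w | (\sum_(i < n) Ys i w) / Num.sqrt (n%:R * s2) <= 0] =
    [set w | \sum_(i < n) Ys i w <= 0].
  apply/seteqP; split => w /=; rewrite pmulr_lle0// invr_gt0 sqrtr_gt0;
    by rewrite mulr_gt0 // ltr0n.
set A := [set w | _].
have mA : measurable A.
  have mS : measurable_fun setT (fun w => \sum_(i < n) Ys i w).
    exact: measurable_sum.
  have -> : A = (fun w => \sum_(i < n) Ys i w) @^-1` `]-oo, 0]%classic.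
    by apply/seteqP; split => w /=; rewrite in_itv.
  by rewrite -[X in measurable X]setTI; exact: mS.
rewrite ler_distl => /andP[_ H].
rewrite -(@fineK _ (P A)) ?fin_num_measure// lee_fin (le_trans H)// lerD2l.
have n0' : 0 < Num.sqrt (n%:R : R) by rewrite sqrtr_gt0 ltr0n.
rewrite -mulrA ler_pM2l ?divr_gt0// -/s ler_pdivrMr ?exprn_gt0//.
by rewrite -lee_fin fineK// ge0_fin_numE// (le_lt_trans E3)// ltry.
Qed.

Lemma mutually_independent_comp (n : nat) (X Y : 'I_n -> {RV P >-> R})
    (f : R -> R) : measurable_fun setT f ->
  (forall i w, Y i w = f (X i w)) ->
  mutually_independent X -> mutually_independent Y.
Proof.
move=> mf YE ind B mB.
have YB i : Y i @^-1` B i = X i @^-1` (f @^-1` B i).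
  by apply/seteqP; split => w /=; rewrite YE.
under eq_bigcapr do rewrite YB.
rewrite ind; last first.
  by move=> i; rewrite -[X in measurable X]setTI; exact: mf.
by apply: eq_bigr => i _; rewrite YB.
Qed.

End berry_esseen.

(** * Centered gamma variables and the probability of one side of the mean *)

Section gamma_centered.
Context (d : measure_display) (T : measurableType d) (R : realType)
  (P : probability T R) (k theta : R).
Hypotheses (k0 : 0 < k) (theta0 : 0 < theta).

(** Binomial expansion in the raw moments; [3 + 6 / k] is the kurtosis of the gamma law. *)
Lemma gamma_central_moments (X : {RV P >-> R}) :
  gamma_distributed k theta X ->
  [/\ has_expectation P (fun w => X w - k * theta) 0,
      has_expectation P (fun w => (X w - k * theta) ^+ 2) (k * theta ^+ 2) &
      has_expectation P (fun w => (X w - k * theta) ^+ 4)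
        ((3 + 6 / k) * (k * theta ^+ 2) ^+ 2)].
Proof.
move=> gX; pose c := k * theta.
have k_neq0 : k != 0 by rewrite gt_eqF.
have M j := gamma_moment j k0 theta0 gX.
split.
- apply: (has_expectation_eq
    (has_expectationD (M 1) (has_expectation_cst P (- c)))) => //.
  by rewrite big_ord1 /c /=; ring.
- apply: (has_expectation_eq (has_expectationD (M 2) (has_expectationD
    (has_expectationZ (- 2 * c) (M 1)) (has_expectation_cst P (c ^+ 2))))).
  + by move=> w /=; rewrite -/c; ring.
  + by rewrite !big_ord_recr big_ord0 /c /=; ring.
- apply: (has_expectation_eq (has_expectationD (M 4) (has_expectationD
    (has_expectationZ (- 4 * c) (M 3)) (has_expectationD
    (has_expectationZ (6 * c ^+ 2) (M 2)) (has_expectationD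
    (has_expectationZ (- 4 * c ^+ 3) (M 1))
    (has_expectation_cst P (c ^+ 4))))))).
  + by move=> w /=; rewrite -/c; ring.
  + by rewrite !big_ord_recr big_ord0 /c /=; field.
Qed.

Variables (C : R) (n : nat) (X : 'I_n -> {RV P >-> R}).
Hypotheses (C0 : 0 < C) (HC : berry_esseen_constant C) (n0 : (0 < n)%N).
Hypotheses (ind : mutually_independent X)
  (gX : forall i, gamma_distributed k theta (X i)).

(** The sign [s] treats both sides of the mean at once: the second and fourth moments do not see it,
    and the mean is 0 either way. *)
Lemma gamma_sum_half (s : R) : s ^+ 2 = 1 ->
  (P [set w | (s * (\sum_(i < n) X i w - n%:R * (k * theta)) <= 0)%R] <=
  (1 / 2 + Num.min (1 / 2) (C / Num.sqrt n%:R * (3 + 6 / k) `^ (3 / 4)))%:E)%E.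
Proof.
move=> s2.
pose f (x : R) := s * (x - k * theta).
have mf : measurable_fun setT f.
  by apply: measurable_funM => //; exact: measurable_funB.
have mfX i : measurable_fun setT (fun w => f (X i w)) by exact: measurableT_comp.
pose Y i : {RV P >-> R} := mk_rv P (mfX i).
have indY : mutually_independent Y.
  exact: (mutually_independent_comp mf _ ind).
pose i0 := Ordinal n0.
have sameY i : same_distribution (Y i) (Y i0).
  move=> A mA.
  have mfA : measurable (f @^-1` A) by rewrite -[X in measurable X]setTI; exact: mf.
  by rewrite -![Y _ @^-1` A]/(X _ @^-1` (f @^-1` A)) !gX.
have [E1 E2 E4] := gamma_central_moments (gX i0).
pose kappa := 3 + 6 / k.
have kappa1 : 1 <= kappa.
  have : 0 <= 6 / k by rewrite divr_ge0// ltW.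
  rewrite /kappa; lra.
have kappa0 : 0 < kappa by rewrite (lt_le_trans ltr01).
have F1 : has_expectation P (Y i0) 0.
  by apply: has_expectation_eq (has_expectationZ s E1) _ _ => //; rewrite mulr0.
have F2 : has_expectation P (fun w => Y i0 w ^+ 2) (k * theta ^+ 2).
  by apply: has_expectation_eq E2 _ _ => // w; rewrite /= /f exprMn s2 mul1r.
have F4 : has_expectation P (fun w => Y i0 w ^+ 4) (kappa * (k * theta ^+ 2) ^+ 2).
  apply: has_expectation_eq E4 _ _ => // w.
  by rewrite /= /f [RHS]exprMn (exprM s 2 2) s2 expr1n mul1r.
have v0 : 0 < k * theta ^+ 2 by rewrite mulr_gt0// exprn_gt0.
have := berry_esseen_sum_le0 C0 HC n0 indY sameY v0 kappa0 F1 F2 F4.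
have -> : [set w | (\sum_(i < n) Y i w <= 0)%R] =
    [set w | (s * (\sum_(i < n) X i w - n%:R * (k * theta)) <= 0)%R].
  apply/seteqP; split => w /=; rewrite -mulr_sumr sumrB sumr_const card_ord;
    by rewrite mulr_natl.
set A := [set w | _] => BE.
have mA : measurable A.
  have mS : measurable_fun setT
      (fun w => s * (\sum_(i < n) X i w - n%:R * (k * theta))).
    apply: measurable_funM => //; apply: measurable_funB => //.
    exact: measurable_sum.
  have -> : A = (fun w => s * (\sum_(i < n) X i w - n%:R * (k * theta))) @^-1`
      `]-oo, 0]%classic.
    by apply/seteqP; split => w /=; rewrite in_itv.
  by rewrite -[X in measurable X]setTI; exact: mS.
(* If the minimum is [1 / 2], the claimed bound is 1. *)
have [_|_] := leP (1 / 2) (C / Num.sqrt n%:R * kappa `^ (3 / 4)).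
  have -> : (1 / 2 + 1 / 2 : R) = 1 by lra.
  exact: probability_le1.
apply: (le_trans BE); rewrite lee_fin lerD2l ler_pM2l; last first.
  by rewrite divr_gt0// sqrtr_gt0 ltr0n.
(* Since [kappa >= 1], its square root is at most its power [3 / 4]. *)
rewrite -powR12_sqrt ?ler_powR// ?(ltW kappa0)//.
lra.
Qed.

End gamma_centered.

(** * Assembly of the two tail bounds *)

Lemma powR_mul_expR (R : realType) (r a : R) : 0 < r ->
  (r * expR (1 - r)) `^ a = r `^ a * expR ((1 - r) * a).
Proof.
move=> r0; rewrite powRM ?ltW ?expR_gt0//; congr (_ * _).
by rewrite /powR gt_eqF ?expR_gt0// expRK mulrC.
Qed.

Theorem theorem9 (R : realType) (C : R) (HC0 : 0 < C)
  (HC : berry_esseen_constant C) (k theta : R) (hk : 0 < k) (htheta : 0 < theta)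
  (n : nat) (hn : (0 < n)%N)
  (d : measure_display) (T : measurableType d) (P : probability T R)
  (X : 'I_n -> {RV P >-> R})
  (Hind : mutually_independent X) (Hgam : forall i, gamma_distributed k theta (X i)) :
  let Xbar := fun w => (\sum_(i < n) X i w) / n%:R in
  let Delta := Num.min (1 / 2) (C / Num.sqrt n%:R * (3 + 6 / k) `^ (3 / 4)) in
  (forall rho : R, 0 < rho <= 1 ->
     (P [set w | (Xbar w <= rho * k * theta)%R] <=
      ((1 / 2 + Delta) * (rho * expR (1 - rho)) `^ (k * n%:R))%:E)%E) /\
  (forall rho : R, 1 <= rho ->
     (P [set w | (Xbar w >= rho * k * theta)%R] <=
      ((1 / 2 + Delta) * (rho * expR (1 - rho)) `^ (k * n%:R))%:E)%E).
Proof.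
move=> Xbar Delta.
have n0 : 0 < n%:R :> R by rewrite ltr0n.
pose S : {RV P >-> R} := mk_rv P (measurable_psum X n).
have SE w : S w = \sum_(i < n) X i w.
  by rewrite /= /psum; apply: eq_bigl => i; rewrite ltn_ord.
have sS : exp_scaling P theta (k * n%:R) S.
  apply: psum_exp_scaling => // i; exact: gamma_exp_scaling.
pose c := n%:R * (k * theta).
(* Both tails are instances, with [D] the half-line ending at the mean [c] of [S]. *)
have tailE (rho : R) (D : set R) : 0 < rho -> measurable D ->
    (forall x, D x -> (1 - rho) * x <= (1 - rho) * c) ->
    (P [set w | D (S w)] <= (1 / 2 + Delta)%:E)%E ->
    (P [set w | D (S w / rho)%R] <=
     ((1 / 2 + Delta) * (rho * expR (1 - rho)) `^ (k * n%:R))%:E)%E.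
  move=> rho0 mD Dc half.
  apply: (le_trans (exp_scaling_tail htheta sS rho0 mD Dc)).
  have -> : (1 - rho) * c / theta = (1 - rho) * (k * n%:R).
    by rewrite /c; field; rewrite gt_eqF.
  by rewrite -powR_mul_expR// [_ * _ `^ _]mulrC EFinM lee_wpmul2l// lee_fin powR_ge0.
have XbarE (rho : R) w : 0 < rho -> Xbar w = rho * (S w / rho) / n%:R.
  by move=> rho0; rewrite /Xbar -SE mulrCA mulfV ?gt_eqF// mulr1.
have cE rho : rho * k * theta * n%:R = rho * c by rewrite /c; ring.
split=> rho.
  move=> /andP[rho0 rho1].
  have -> : [set w | (Xbar w <= rho * k * theta)%R] =
      [set w | `]-oo, c]%classic (S w / rho)].
    have E w : (Xbar w <= rho * k * theta) = (S w / rho <= c).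
      by rewrite (XbarE rho)// [LHS]ler_pdivrMr// cE ler_pM2l.
    by apply/seteqP; split => w /=; rewrite in_itv E.
  apply: tailE => //.
    move=> x /=; rewrite in_itv/= => xc.
    by rewrite ler_wpM2l// subr_ge0.
  (* The lower side of the mean is the sign [s = 1]. *)
  have := gamma_sum_half hk htheta HC0 HC hn Hind Hgam (expr1n _ 2).
  congr (P _ <= _)%E; apply/seteqP; split => w /=;
    by rewrite in_itv/= mul1r subr_le0 -SE.
move=> rho1; have rho0 : 0 < rho by rewrite (lt_le_trans ltr01).
have -> : [set w | (Xbar w >= rho * k * theta)%R] =
    [set w | `[c, +oo[%classic (S w / rho)].
  have E w : (rho * k * theta <= Xbar w) = (c <= S w / rho).
    by rewrite (XbarE rho)// [LHS]ler_pdivlMr// cE ler_pM2l.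
  by apply/seteqP; split => w /=; rewrite in_itv/= andbT E.
apply: tailE => //.
  move=> x /=; rewrite in_itv/= andbT => xc.
  by rewrite ler_wnM2l// subr_le0.
(* The upper side of the mean is the sign [s = -1]. *)
have N1 : (-1 : R) ^+ 2 = 1 by rewrite sqrrN expr1n.
have := gamma_sum_half hk htheta HC0 HC hn Hind Hgam N1.
congr (P _ <= _)%E; apply/seteqP; split => w /=;
  by rewrite in_itv/= andbT mulN1r oppr_le0 subr_ge0 -SE.
Qed.
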